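(* Let $F$ be a number field Galois over $\mathbb Q$, $M$ an even integer divisible by the discriminant of $F$, $n\ge1$, $i\mapsto\sigma_i\in\mathrm{Gal}(F/\mathbb Q)$ ($i=1,\dots,n$, $\sigma_1=\mathrm{id}$) a vertical gauge, $p$ a prime not dividing $M$, $\mathfrak P$ a prime of $\mathcal O_F$ dividing $p$, and $q\in GL_n(\mathcal O_F[1/M])$ with $q^t=q$. Assume $q$ is vertical gauge invariant, i.e. $\sigma_i(q)=q$ for $i=1,\dots,n$. Let $(\varphi_{ij})$ be the curvature of the vertical Levi-Civita connection attached to $q$ at $\mathfrak P$, $\Phi_{ij}:=\varphi_{ij}(x)$, $\Psi_{ij}=(\Psi_{ijmk})_{m,k}:=(x^{(p^2)})^{-1}\Phi_{ij}$, and $R_{ik}:=\sum_{j=1}^n\Psi_{jijk}$ (i.e. the sum over $j$ of the $(j,k)$ entries of the matrices $\Psi_{ji}$). Then for all $i,k$ the following congruence holds in $\mathcal O(\widehat{G^1})$: $$R_{ik}\equiv R_{ki}\quad\text{mod }p.$$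
   Context: For a matrix $a=(a_{ij})$, $a^t$ is the transpose, $a^{(p)}=(a_{ij}^p)$ and $a^{(p^2)}=(a_{ij}^{p^2})$; set maps between rings are applied to matrices entrywise. A Frobenius lift on a ring $A$ is a ring endomorphism reducing mod $p$ to the $p$-power Frobenius of $A/pA$. On a $p$-torsion free ring a $p$-derivation $\delta$ is the same as a Frobenius lift $\phi$, via $\phi(a)=a^p+p\,\delta a$ (''attached''). $\widehat{\ }$ denotes $p$-adic completion. Set $\mathfrak P_i=\sigma_i\mathfrak P$ and let $R_i=\widehat{\mathcal O_{\mathfrak P_i}}$ be the $p$-adic completion of the localization of $\mathcal O_F$ at $\mathfrak P_i$ (a complete discrete valuation ring with maximal ideal generated by the odd prime $p$). It has a unique Frobenius lift $\phi^i$, hence a unique $p$-derivation $\delta^i$. Let $x$ be an $n\times n$ matrix of indeterminates, $G^i=\mathrm{Spec}\,R_i[x,\det(x)^{-1}]$, $\mathcal O(\widehat{G^i})=R_i[x,\det(x)^{-1}]^{\widehat{\ }}$. The automorphism $\sigma_i$ induces an isomorphism $R_1\to R_i$, extended to $\sigma_i:\mathcal O(\widehat{G^1})\to\mathcal O(\widehat{G^i})$ by $\sigma_i(x)=x$. A vertical connection at $\mathfrak P$ is an $n$-tuple $(\delta^1,\dots,\delta^n)$ where $\delta^i$ is a $p$-derivation on $\mathcal O(\widehat{G^i})$ extending that of $R_i$ (same notation), with attached Frobenius lift $\phi^i$. It is metric with respect to $q$ if for every $i$, $\phi^i\circ\mathcal H_q=\mathcal H_q\circ\phi^i_0$, where $\mathcal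 H_q$ is the (continuous) $R_i$-algebra endomorphism of $\mathcal O(\widehat{G^i})$ with $x\mapsto x^tqx$ and $\phi_0^i$ is the Frobenius lift extending that of $R_i$ with $\phi_0^i(x)=x^{(p)}$. With $\gamma_i=(\gamma_{ijk})_{j,k}:=(\delta^ix)^t\cdot\phi^i(q)\cdot x^{(p)}$, it is torsion free relative to $q$ if $\sigma_i^{-1}\gamma_{ijk}=\sigma_j^{-1}\gamma_{jik}$ for all $i,j,k$. The vertical Levi-Civita connection attached to $q$ at $\mathfrak P$ is the unique (it exists) vertical connection that is metric with respect to $q$ and torsion free relative to $q$. Its curvature is the family of additive maps $\varphi_{ij}:\mathcal O(\widehat{G^1})\to\mathcal O(\widehat{G^1})$, $$\varphi_{ij}=\frac1p\{\sigma_i^{-1}\phi^i\sigma_i\sigma_j^{-1}\phi^j\sigma_j-\sigma_j^{-1}\phi^j\sigma_j\sigma_i^{-1}\phi^i\sigma_i\}$$ (composition of maps, rightmost first). *)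

(* Defs.v *)
From HB Require Import structures.
From mathcomp Require Import all_boot all_order all_fingroup all_algebra all_field.
From mathcomp Require Import boolp classical_sets functions generic_quotient mpoly.

Set Implicit Arguments.
Unset Strict Implicit.
Unset Printing Implicit Defensive.

Import GRing.Theory.
Local Open Scope ring_scope.
Local Open Scope quotient_scope.

Definition congr_mod (A : comNzRingType) (p : nat) (a b : A) : Prop :=
  exists c : A, a - b = p%:R * c.

(* [p] is not invertible in [A]: the condition under which the [p]-adic
   completion of [A] is a nonzero ring. *)
Definition nonunit_nat (A : comNzRingType) (p : nat) : Prop :=
  forall y : A, p%:R * y <> 1.

(* The [p]-adic completion [lim_k A / p^k A] is presented as the ring of sequences [u : nat -> A] with
   [u (k+1) = u k] mod [p^k], modulo those with [u k = 0] mod [p^k] for all k. *)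

Section Completion.
Variables (A : comNzRingType) (p : nat).

Definition coherent : {pred nat -> A} :=
  fun u => `[< forall k, congr_mod (p ^ k) (u k.+1) (u k) >].

Fact coherent_subring : subring_closed coherent.
Proof.
split=> [|u v /asboolP hu /asboolP hv|u v /asboolP hu /asboolP hv].
- by apply/asboolP => k; exists 0; rewrite subrr mulr0.
- apply/asboolP => k; have [c hc] := hu k; have [d hd] := hv k.
  exists (c - d); rewrite mulrBr -hc -hd.
  rewrite -[(u - v) k.+1]/(u k.+1 - v k.+1) -[(u - v) k]/(u k - v k).
  by rewrite !opprB addrACA [RHS]addrACA [- v k.+1 - _]addrC.
- apply/asboolP => k; have [c hc] := hu k; have [d hd] := hv k.
  exists (c * v k.+1 + u k * d); rewrite mulrDr mulrA -hc mulrCA -hd.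
  rewrite -[(u * v) k.+1]/(u k.+1 * v k.+1) -[(u * v) k]/(u k * v k).
  by rewrite mulrBl mulrBr addrA subrK.
Qed.

HB.instance Definition _ :=
  GRing.isSubringClosed.Build (nat -> A) coherent coherent_subring.

Record coherent_seq : Type :=
  CoherentSeq { seq_val :> nat -> A; _ : seq_val \in coherent }.

HB.instance Definition _ := [isSub for seq_val].
HB.instance Definition _ := [Choice of coherent_seq by <:].
HB.instance Definition _ := [SubChoice_isSubComNzRing of coherent_seq by <:].

Fact const_coherent (a : A) : (fun=> a) \in coherent.
Proof. by apply/asboolP => k; exists 0; rewrite subrr mulr0. Qed.

Definition null_seq (_ : nonunit_nat A p) : {pred coherent_seq} :=
  fun u => `[< forall k, congr_mod (p ^ k) (u k) 0 >].

Variable pA : nonunit_nat A p.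

Fact null_seq_ideal : idealr_closed (null_seq pA).
Proof.
split=> [||a u v /asboolP hu /asboolP hv].
- by apply/asboolP => k; exists 0; rewrite subrr mulr0.
- apply/negP => /asboolP /(_ 1%N) [c]; rewrite subr0 expn1 => h.
  by apply: (pA (y := c)); rewrite -h.
- apply/asboolP => k; have [c hc] := hu k; have [d hd] := hv k.
  exists (a k * c + d); move: hc hd; rewrite !subr0 mulrDr mulrCA => <- <-.
  by [].
Qed.

HB.instance Definition _ :=
  isIdealr.Build coherent_seq (null_seq pA) null_seq_ideal.

Definition completion : Type := {ideal_quot (null_seq pA)}.

HB.instance Definition _ := GRing.ComNzRing.on completion.

Definition to_completion (a : A) : completion :=
  \pi_({ideal_quot (null_seq pA)}) (CoherentSeq (const_coherent a)).

Definition compl_unit : {pred completion} := fun x => `[< exists y, y * x = 1 >].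
Definition compl_inv (x : completion) : completion :=
  if pselect (exists y, y * x = 1) is left h then sval (cid h) else x.

Fact compl_mulVx : {in compl_unit, left_inverse 1 compl_inv *%R}.
Proof.
move=> x /asboolP h; rewrite /compl_inv; case: pselect => // h'.
exact: (svalP (cid h')).
Qed.

Fact compl_unitPl x y : y * x = 1 -> compl_unit x.
Proof. by move=> h; apply/asboolP; exists y. Qed.

Fact compl_inv_out : {in [predC compl_unit], compl_inv =1 id}.
Proof.
move=> x /asboolP h; rewrite /compl_inv; case: pselect => // h'.
Qed.

HB.instance Definition _ := GRing.ComNzRing_hasMulInverse.Build completion
  compl_mulVx compl_unitPl compl_inv_out.

End Completion.

Fact completion_nonunit (A : comNzRingType) (p : nat) (pA : nonunit_nat A p) :
  nonunit_nat (completion pA) p.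
Proof.
move=> y; pose Q := {ideal_quot (null_seq pA)}; pose u : coherent_seq A p := repr (y : Q).
change ((p%:R * (y : Q) = 1 :> Q) -> False).
rewrite -[y : Q]reprK -/u -(rmorph_nat \pi_Q) -(rmorph1 \pi_Q) -rmorphM => /eqP.
rewrite -Quotient.idealrBE => /asboolP /(_ 1%N) [c].
have E (k : nat) : seq_val (k%:R : coherent_seq A p) 1%N = k%:R.
  rewrite -[seq_val _]/(val (k%:R : coherent_seq A p)) rmorph_nat.
  elim: k => // k IH; rewrite -[in LHS]addn1 natrD.
  by rewrite -[LHS]/((k%:R : nat -> A) 1%N + 1) IH -[in RHS]addn1 natrD.
rewrite -[seq_val _ _]/(seq_val p%:R 1%N * u 1%N - 1) E subr0 expn1 => h.
by apply: (pA (u 1%N - c)); rewrite mulrBr -h opprB addrC subrK.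
Qed.

(* The coordinate ring [R[x, 1/det x]] of GL_n, with [x] an n x n matrix of
   indeterminates, is presented as [R[x][Y] / (det x * Y - 1)]. Evaluation at
   [x = 1], [Y = 1] shows that it is nonzero. *)

Section GLCoordinateRing.
Variables (R : comNzRingType) (n : nat).

Definition generic_mx : 'M[{mpoly R[n * n]}]_n :=
  \matrix_(i, j) 'X_(mxvec_index i j).

Definition inv_det_rel : {poly {mpoly R[n * n]}} := (\det generic_mx)%:P * 'X - 1.

Definition inv_det_ideal : {pred {poly {mpoly R[n * n]}}} :=
  fun f => `[< exists g, f = g * inv_det_rel >].

Definition eval_at_1 (f : {poly {mpoly R[n * n]}}) : R :=
  f.[1].@[fun k => mxvec (1%:M : 'M[R]_n) 0 k].

Fact eval_at_1_rel : eval_at_1 inv_det_rel = 0.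
Proof.
rewrite /eval_at_1 /inv_det_rel !hornerE rmorphB /=.
set v := fun k => _; have -> : (\det generic_mx).@[v] = 1; last by rewrite meval1 subrr.
rewrite -(det_map_mx (meval v)) -[RHS](det1 R n); congr (\det _).
apply/matrixP => i j; rewrite mxE [generic_mx i j]mxE.
by apply: (etrans (mevalXU _ _)); rewrite /v mxvecE.
Qed.

Fact eval_at_1_ideal f : f \in inv_det_ideal -> eval_at_1 f = 0.
Proof.
case/asboolP=> g ->; have := eval_at_1_rel; rewrite /eval_at_1 hornerM mevalM => ->.
by rewrite mulr0.
Qed.

Fact inv_det_idealr : idealr_closed inv_det_ideal.
Proof.
split=> [||a f g /asboolP[f' ->] /asboolP[g' ->]].
- by apply/asboolP; exists 0; rewrite mul0r.
- apply/negP => /eval_at_1_ideal; rewrite /eval_at_1 hornerC meval1 => /eqP.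
  by rewrite oner_eq0.
- by apply/asboolP; exists (a * f' + g'); rewrite mulrDl mulrA.
Qed.

HB.instance Definition _ :=
  isIdealr.Build {poly {mpoly R[n * n]}} inv_det_ideal inv_det_idealr.

Definition GL_ring : Type := {ideal_quot inv_det_ideal}.

HB.instance Definition _ := GRing.ComNzRing.on GL_ring.

Definition GL_ring_of (f : {mpoly R[n * n]}) : GL_ring :=
  \pi_({ideal_quot inv_det_ideal}) f%:P.

Fact GL_ring_nonunit (p : nat) : nonunit_nat R p -> nonunit_nat GL_ring p.
Proof.
move=> pR y; pose Q := {ideal_quot inv_det_ideal}.
change ((p%:R * (y : Q) = 1 :> Q) -> False).
rewrite -[y : Q]reprK -(rmorph_nat \pi_Q) -(rmorph1 \pi_Q) -rmorphM => /eqP.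
rewrite -Quotient.idealrBE => /eval_at_1_ideal.
rewrite /eval_at_1 hornerD hornerN hornerM hornerC -[p%:R]polyC_natr hornerC.
rewrite mevalB mevalM meval1 rmorph_nat => /eqP.
by rewrite subr_eq0 => /eqP; apply: pR.
Qed.

End GLCoordinateRing.

(* A [splittingFieldType rat] is a finite normal extension of the rationals; in
   characteristic 0 this is the same as a finite Galois extension. *)

Section NumberField.
Variable F : splittingFieldType rat.

Definition OF : {pred F} := fun x => `[< integralOver (intr : int -> F) x >].

Definition OF_inv (M : int) : {pred F} :=
  fun x => `[< exists k : nat, M%:~R ^+ k * x \in OF >].

Definition integral_basis (m : nat) (b : 'I_m -> F) : Prop :=
  (forall i, b i \in OF) /\
  (forall x, x \in OF ->
     exists! c : {ffun 'I_m -> int}, x = \sum_i b i *~ c i).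

(* [d] is the discriminant of [F]; as [F] is Galois, the trace to the rationals
   is [galTrace], with values in the image of the rationals in [F]. *)
Definition is_discriminant (d : int) : Prop :=
  exists (m : nat) (b : 'I_m -> F),
    integral_basis b /\
    d%:~R = \det (\matrix_(i, j) galTrace 1%VS {:F}%VS (b i * b j)).

(* The prime ideals of [OF] dividing [p], that is, containing [p]. *)
Record prime_ideal_over (p : nat) : Type := PrimeIdealOver {
  prime_set :> {pred F};
  prime_sub : {subset prime_set <= OF};
  prime_0 : 0 \in prime_set;
  prime_add : {in prime_set &, forall x y, x + y \in prime_set};
  prime_mul : {in OF & prime_set, forall a x, a * x \in prime_set};
  prime_1 : 1 \notin prime_set;
  prime_prime : {in OF &, forall a b,
    a * b \in prime_set -> (a \in prime_set) || (b \in prime_set)};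
  prime_p : p%:R \in prime_set }.

Fact OF_subring : subring_closed OF.
Proof.
split=> [|x y /asboolP hx /asboolP hy|x y /asboolP hx /asboolP hy]; apply/asboolP.
- exact: integral1.
- exact: integral_sub.
- exact: integral_mul.
Qed.

HB.instance Definition _ := GRing.isSubringClosed.Build F OF OF_subring.

Fact gal_OF (s : gal_of {:F}%VS) x : x \in OF -> s x \in OF.
Proof.
move=> /asboolP h; apply/asboolP; have := integral_rmorph s h.
suff -> : s \o intr = intr :> (int -> F) by [].
by apply: funext => z /=; rewrite rmorph_int.
Qed.

Fact gal_VK (s : gal_of {:F}%VS) : cancel (s^-1)%g s.
Proof. by move=> x; rewrite -galM ?memvf // mulVg gal_id. Qed.

Fact gal_KV (s : gal_of {:F}%VS) : cancel s (s^-1)%g.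
Proof. by move=> x; rewrite -galM ?memvf // mulgV gal_id. Qed.

Section GalPrime.
Variables (p : nat) (s : gal_of {:F}%VS) (P : prime_ideal_over p).

(* the image [s P]: [y] lies in it iff [s^-1 y] lies in [P] *)
Definition gal_set : {pred F} := fun y => (s^-1)%g y \in (P : {pred F}).

Fact gal_set_image y :
  y \in gal_set <-> exists2 x, x \in (P : {pred F}) & y = s x.
Proof.
split=> [h|[x xP ->]]; first by exists ((s^-1)%g y); rewrite ?gal_VK.
by rewrite unfold_in gal_KV.
Qed.

Fact gal_prime_sub : {subset gal_set <= OF}.
Proof. by move=> y /(@prime_sub _ P) /(gal_OF s); rewrite gal_VK. Qed.

Fact gal_prime_0 : 0 \in gal_set.
Proof. by rewrite unfold_in rmorph0 prime_0. Qed.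

Fact gal_prime_add : {in gal_set &, forall x y, x + y \in gal_set}.
Proof. by move=> x y hx hy; rewrite unfold_in rmorphD prime_add. Qed.

Fact gal_prime_mul : {in OF & gal_set, forall a x, a * x \in gal_set}.
Proof. by move=> a x ha hx; rewrite unfold_in rmorphM prime_mul // gal_OF. Qed.

Fact gal_prime_1 : 1 \notin gal_set.
Proof. by rewrite unfold_in rmorph1 prime_1. Qed.

Fact gal_prime_prime : {in OF &, forall a b,
  a * b \in gal_set -> (a \in gal_set) || (b \in gal_set)}.
Proof.
move=> a b ha hb; rewrite !unfold_in rmorphM.
by apply: prime_prime; apply: gal_OF.
Qed.

Fact gal_prime_p : p%:R \in gal_set.
Proof. by rewrite unfold_in rmorph_nat prime_p. Qed.

Definition gal_prime : prime_ideal_over p :=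
  PrimeIdealOver gal_prime_sub gal_prime_0 gal_prime_add gal_prime_mul gal_prime_1
    gal_prime_prime gal_prime_p.

End GalPrime.

Section Localization.
Variables (p : nat) (P : prime_ideal_over p).

Definition in_localization : {pred F} := fun z =>
  `[< exists a s, [/\ a \in OF, s \in OF, s \notin (P : {pred F}) & z = a / s] >].

Fact in_localization_subring : subring_closed in_localization.
Proof.
have nz s : s \notin (P : {pred F}) -> s != 0.
  by apply: contraNneq => ->; apply: prime_0.
have nM s t : s \in OF -> t \in OF -> s \notin (P : {pred F}) ->
    t \notin (P : {pred F}) -> s * t \notin (P : {pred F}).
  move=> hs ht sP tP; apply/negP => /(prime_prime hs ht).
  by rewrite (negPf sP) (negPf tP).
split=> [|x y|x y].
- by apply/asboolP; exists 1, 1; rewrite rpred1 prime_1 divr1.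
- move=> /asboolP[a [s [ha hs sP ->]]] /asboolP[b [t [hb ht tP ->]]].
  apply/asboolP; exists (a * t - b * s), (s * t).
  by rewrite rpredB ?rpredM ?nM // -mulNr addf_div ?nz // mulNr.
- move=> /asboolP[a [s [ha hs sP ->]]] /asboolP[b [t [hb ht tP ->]]].
  apply/asboolP; exists (a * b), (s * t).
  by rewrite !rpredM ?nM // mulf_div.
Qed.

HB.instance Definition _ :=
  GRing.isSubringClosed.Build F in_localization in_localization_subring.

Record localization : Type :=
  Localization { loc_val :> F; _ : loc_val \in in_localization }.

HB.instance Definition _ := [isSub for loc_val].
HB.instance Definition _ := [Choice of localization by <:].
HB.instance Definition _ := [SubChoice_isSubComNzRing of localization by <:].

Fact localization_nonunit : nonunit_nat localization p.
Proof.
case=> y hy /(congr1 loc_val).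
rewrite -[LHS]/(val ((p%:R : localization) * Localization hy)) rmorphM rmorph_nat /=.
rewrite -[RHS]/(val (1 : localization)) rmorph1 => h.
case/asboolP: (hy) => a [s [ha hs sP yE]]; case/negP: (sP).
have s0 : s != 0 by apply: contraNneq sP => ->; apply: prime_0.
have -> : s = a * p%:R.
  by have := mul1r s; rewrite -{1}h yE mulrA divfK // mulrC => <-.
exact: prime_mul (prime_p P).
Qed.

Definition Rhat : Type := completion localization_nonunit.
HB.instance Definition _ := GRing.ComUnitRing.on Rhat.

(* Meaningful on the localization only: other elements of [F] go to 0. *)
Definition to_Rhat (z : F) : Rhat :=
  to_completion localization_nonunit (insubd 0 z).

Variable n : nat.

Fact GL_Rhat_nonunit : nonunit_nat (GL_ring Rhat n) p.
Proof. exact/GL_ring_nonunit/completion_nonunit. Qed.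

Definition OGhat : Type := completion GL_Rhat_nonunit.
HB.instance Definition _ := GRing.ComUnitRing.on OGhat.

Definition poly_to_OGhat (f : {mpoly Rhat[n * n]}) : OGhat :=
  to_completion GL_Rhat_nonunit (GL_ring_of f).

Definition Rhat_to_OGhat (r : Rhat) : OGhat := poly_to_OGhat r%:MP.

Definition F_to_OGhat (z : F) : OGhat := Rhat_to_OGhat (to_Rhat z).

Definition xmx : 'M[OGhat]_n := map_mx poly_to_OGhat (generic_mx Rhat n).

End Localization.

(* Hence [to_Rhat] is never applied to a junk value below, where the entries of
   [q] are in [OF_inv M]. *)
Fact OF_inv_localization (p : nat) (P : prime_ideal_over p) (M : int) :
  prime p -> ~~ (p %| M)%Z -> {subset OF_inv M <= in_localization P}.
Proof.
move=> p_pr pM x /asboolP[k hx].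
have intOF (z : int) : z%:~R \in OF by rewrite rpred_int.
have MP : M%:~R \notin (P : {pred F}).
  have : coprimez p M by rewrite coprimezE prime_coprime.
  move=> /coprimezP[[u v] /= uv]; apply/negP => hM; case/negP: (prime_1 P).
  rewrite -[1]/(1%:~R) -uv rmorphD !rmorphM /=.
  by rewrite prime_add // prime_mul // prime_p.
have MkP : M%:~R ^+ k \notin (P : {pred F}).
  elim: k {hx} => [|k IH]; first by rewrite expr0 prime_1.
  rewrite exprS; apply/negP => /(prime_prime (intOF M) (rpredX k (intOF M))).
  by rewrite (negPf MP) (negPf IH).
have Mk0 : M%:~R ^+ k != 0 :> F by apply: contraNneq MkP => ->; apply: prime_0.
apply/asboolP; exists (M%:~R ^+ k * x), (M%:~R ^+ k).
by rewrite hx rpredX // mulrAC divff // mul1r.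
Qed.

End NumberField.

Arguments OF : clear implicits.
Arguments OF_inv : clear implicits.

Section PDerivation.
Variables (A : comNzRingType) (p : nat).

(* [(x^p + y^p - (x + y)^p) / p], as a polynomial with integer coefficients *)
Definition pder_carry (x y : A) : A :=
  - \sum_(1 <= k < p) ('C(p, k) %/ p)%:R * x ^+ k * y ^+ (p - k).

Definition p_derivation (delta : A -> A) : Prop :=
  [/\ delta 1 = 0,
      forall x y, delta (x + y) = delta x + delta y + pder_carry x y
    & forall x y, delta (x * y) =
        x ^+ p * delta y + y ^+ p * delta x + p%:R * delta x * delta y].

Definition attached_lift (delta : A -> A) : A -> A :=
  fun a => a ^+ p + p%:R * delta a.

Definition is_frobenius_lift (phi : {rmorphism A -> A}) : Prop :=
  forall a, congr_mod p (phi a) (a ^+ p).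

(* [a^(p^e)], the entrywise [p^e]-th power of the matrix [a] *)
Definition mx_frob (e : nat) (m n : nat) (a : 'M[A]_(m, n)) : 'M[A]_(m, n) :=
  map_mx (fun t => t ^+ (p ^ e)) a.

End PDerivation.

(* The gauge is indexed by ['I_N.+1], with [ord0] playing the role of the index
   1, so that the size of the matrices is [n = N.+1]. *)

Section Vertical.
Variables (F : splittingFieldType rat) (p N : nat) (P : prime_ideal_over F p).
Variable sigma : 'I_N.+1 -> gal_of {:F}%VS.
Variable q : 'M[F]_N.+1.

Definition gauge_prime (i : 'I_N.+1) : prime_ideal_over F p := gal_prime (sigma i) P.
Definition R_ (i : 'I_N.+1) : comUnitRingType := Rhat (gauge_prime i).
Definition OG_ (i : 'I_N.+1) : comUnitRingType := OGhat (gauge_prime i) N.+1.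

Definition R_to_OG (i : 'I_N.+1) : R_ i -> OG_ i :=
  @Rhat_to_OGhat F p (gauge_prime i) N.+1.
Definition x_ (i : 'I_N.+1) : 'M[OG_ i]_N.+1 := xmx (gauge_prime i) N.+1.
Definition q_ (i : 'I_N.+1) : 'M[OG_ i]_N.+1 :=
  map_mx (@F_to_OGhat F p (gauge_prime i) N.+1) q.

(* [sR i] is the isomorphism [R_ ord0 -> R_ i] induced by [sigma i] and [s i]
   its extension fixing the coordinates [x]; [sinv i] is the inverse of [s i].
   Ring morphisms are automatically [p]-adically continuous, so that [sR i] and
   [s i] are determined by these equations; likewise for [H] and [phi0] below. *)
Definition gauge_action (sR : forall i, {rmorphism R_ ord0 -> R_ i})
    (s : forall i, {rmorphism OG_ ord0 -> OG_ i})
    (sinv : forall i, OG_ i -> OG_ ord0) : Prop :=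
  forall i,
    [/\ {in in_localization (gauge_prime ord0), forall z,
           sR i (to_Rhat (gauge_prime ord0) z) =
           to_Rhat (gauge_prime i) (sigma i z)},
        forall r, s i (R_to_OG r) = R_to_OG (sR i r),
        map_mx (s i) (x_ ord0) = x_ i,
        cancel (s i) (sinv i) & cancel (sinv i) (s i)].

(* [H i] is the endomorphism [H_q] of [OG_ i]: the [R_ i]-algebra map with
   [x |-> x^t q x]. *)
Definition metric_map (H : forall i, {rmorphism OG_ i -> OG_ i}) : Prop :=
  forall i,
    (forall r, H i (R_to_OG r) = R_to_OG r) /\
    map_mx (H i) (x_ i) = (x_ i)^T *m q_ i *m x_ i.

(* [phi0 i] is the Frobenius lift on [OG_ i] extending that of [R_ i] with
   [x |-> x^(p)]. *)
Definition standard_lift (deltaR : forall i, R_ i -> R_ i)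
    (phi0 : forall i, {rmorphism OG_ i -> OG_ i}) : Prop :=
  forall i,
    [/\ is_frobenius_lift p (phi0 i),
        forall r, phi0 i (R_to_OG r) = R_to_OG (attached_lift p (deltaR i) r)
      & map_mx (phi0 i) (x_ i) = mx_frob p 1 (x_ i)].

Section Connection.
Variables (deltaR : forall i, R_ i -> R_ i) (delta : forall i, OG_ i -> OG_ i).
Arguments deltaR : clear implicits.
Arguments delta : clear implicits.

Definition vertical_connection : Prop :=
  forall i, p_derivation p (delta i) /\
    forall r, delta i (R_to_OG r) = R_to_OG (deltaR i r).

Definition phi_ (i : 'I_N.+1) : OG_ i -> OG_ i := attached_lift p (delta i).
Arguments phi_ : clear implicits.

Definition metric (H phi0 : forall i, {rmorphism OG_ i -> OG_ i}) : Prop :=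
  forall i a, phi_ i (H i a) = H i (phi0 i a).

Definition gamma_ (i : 'I_N.+1) : 'M[OG_ i]_N.+1 :=
  (map_mx (delta i) (x_ i))^T *m map_mx (phi_ i) (q_ i) *m mx_frob p 1 (x_ i).

Definition torsion_free (sinv : forall i, OG_ i -> OG_ ord0) : Prop :=
  forall i j k, sinv i (gamma_ i j k) = sinv j (gamma_ j i k).

(* [sigma_i^-1 phi^i sigma_i], an endomorphism of [OG_ ord0] *)
Definition transported_lift (s : forall i, {rmorphism OG_ ord0 -> OG_ i})
    (sinv : forall i, OG_ i -> OG_ ord0) (i : 'I_N.+1) : OG_ ord0 -> OG_ ord0 :=
  sinv i \o phi_ i \o s i.

(* [varphi i j] is [1/p] times the commutator of the transported lifts; the
   division is unambiguous as [OG_ ord0] is [p]-torsion free. *)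
Definition is_curvature (s : forall i, {rmorphism OG_ ord0 -> OG_ i})
    (sinv : forall i, OG_ i -> OG_ ord0)
    (varphi : 'I_N.+1 -> 'I_N.+1 -> OG_ ord0 -> OG_ ord0) : Prop :=
  let f := transported_lift s sinv in
  forall i j a, p%:R * varphi i j a = f i (f j a) - f j (f i a).

End Connection.

Section Ricci.
Variable varphi : 'I_N.+1 -> 'I_N.+1 -> OG_ ord0 -> OG_ ord0.

Definition Phi_ (i j : 'I_N.+1) : 'M[OG_ ord0]_N.+1 :=
  map_mx (varphi i j) (x_ ord0).

Definition Psi_ (i j : 'I_N.+1) : 'M[OG_ ord0]_N.+1 :=
  invmx (mx_frob p 2 (x_ ord0)) *m Phi_ i j.

Definition Ricci (i k : 'I_N.+1) : OG_ ord0 := \sum_j Psi_ j i j k.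

End Ricci.

End Vertical.

(* Main.v *)
(* Transport everything to the ring A of the index 1: f_i = s_i^-1 phi^i s_i is a
   Frobenius lift of A with f_i(x) = x^(p) + p D_i. Since p is prime to the
   discriminant, every algebraic integer is a p-th power mod p, so all Frobenius
   lifts agree mod p^2 on the entries of q. Put G = (x^(p))^t q^(p) x^(p), K = G^-1,
   and let gamma_i = D_i^t f_i(q) x^(p). Modulo p the metric condition makes
   gamma_i + gamma_i^t independent of i, and the curvature is
   Phi_ji = D_i^(p) - D_j^(p). Hence R_ik is the p-th power of
     sum_(j,l) K_jl gamma_ikl - sum_(j,l) K_jl gamma_jkl.
   By torsion freeness gamma_ikl = gamma_kil, so the first sum is symmetric in i, k,
   and the second is tr(gamma_k K) = tr((gamma_k + gamma_k^t) K) / 2, which does not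
   depend on k. *)

Require Import Defs.
From HB Require Import structures.
From mathcomp Require Import all_boot all_order all_fingroup all_algebra all_field.
From mathcomp Require Import boolp classical_sets functions generic_quotient mpoly.
From mathcomp Require Import ring.

Set Implicit Arguments.
Unset Strict Implicit.
Unset Printing Implicit Defensive.

Import GRing.Theory.
Local Open Scope ring_scope.

(** * Congruences and Frobenius lifts *)

Section Congruences.
Variables (A : comNzRingType) (p : nat).

Definition mod_ideal (_ : nonunit_nat A p) : {pred A} :=
  fun a => `[< congr_mod p a 0 >].

Variable pA : nonunit_nat A p.

Fact mod_ideal_idealr : idealr_closed (mod_ideal pA).
Proof.
split=> [||a u v /asboolP[c hc] /asboolP[d hd]].
- by apply/asboolP; exists 0; rewrite subrr mulr0.
- by apply/negP => /asboolP[c]; rewrite subr0 => h; apply: (pA (y := c)).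
- apply/asboolP; exists (a * c + d); move: hc hd; rewrite !subr0 => -> ->.
  by ring.
Qed.

HB.instance Definition _ := isIdealr.Build A (mod_ideal pA) mod_ideal_idealr.

(** Turns congruences mod [p] into equalities in a ring of characteristic [p], where the [p]-th
    power is a ring morphism. *)
Lemma quotient_mod : exists (B : comNzRingType) (pi : {rmorphism A -> B}),
  forall a b, pi a = pi b <-> congr_mod p a b.
Proof.
exists {ideal_quot (mod_ideal pA)}, (\pi_{ideal_quot (mod_ideal pA)})%qT => a b.
split=> [/eqP|[c h]].
  by rewrite -Quotient.idealrBE => /asboolP[c]; rewrite subr0 => h; exists c.
by apply/eqP; rewrite -Quotient.idealrBE; apply/asboolP; exists c; rewrite subr0.
Qed.

End Congruences.

(** [p] divides the inner binomial coefficients; [pder_carry] is minus the sum of the inner terms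
    with one factor [p] divided out. *)
Lemma expD_prime (A : comNzRingType) (p : nat) (a b : A) : prime p ->
  (a + b) ^+ p = a ^+ p + b ^+ p - p%:R * pder_carry p a b.
Proof.
move=> pp; have p0 := prime_gt0 pp; rewrite addrC exprDn.
rewrite -(big_mkord xpredT (fun k => b ^+ (p - k) * a ^+ k *+ 'C(p, k))).
rewrite big_nat_recr //= big_ltn //= subn0 subnn !expr0 bin0 binn !mulr1n mul1r mulr1.
rewrite /pder_carry mulrN opprK mulr_sumr.
rewrite addrAC [b ^+ p + _]addrC; congr (_ + _).
apply: eq_big_nat => k hk; rewrite -[in LHS](divnK (prime_dvd_bin pp hk)).
by rewrite -mulr_natr natrM; ring.
Qed.

Section Lift.
Variables (A : comNzRingType) (p : nat) (delta : A -> A).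
Hypotheses (pp : prime p) (delta_der : p_derivation p delta).

Fact attached_lift_zmod : zmod_morphism (attached_lift p delta).
Proof.
have [_ dD _] := delta_der.
have D a b : attached_lift p delta (a + b) = attached_lift p delta a + attached_lift p delta b.
  by rewrite /attached_lift dD expD_prime //; ring.
by move=> a b; rewrite -{2}(subrK b a) (D (a - b)) addrK.
Qed.

Fact attached_lift_monoid : monoid_morphism (attached_lift p delta).
Proof.
have [d1 _ dM] := delta_der; split=> [|a b]; rewrite /attached_lift.
  by rewrite d1 expr1n mulr0 addr0.
by rewrite dM exprMn; ring.
Qed.

End Lift.

Section CongruenceCalculus.
Variables (A : comNzRingType) (p : nat).
Hypothesis pp : prime p.

Lemma congr_mod_sym m (a b : A) : congr_mod m a b -> congr_mod m b a.
Proof. by case=> c h; exists (- c); rewrite mulrN -h opprB. Qed.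

Lemma congr_mod_trans m (a b c : A) :
  congr_mod m a b -> congr_mod m b c -> congr_mod m a c.
Proof.
by move=> [u hu] [v hv]; exists (u + v); rewrite mulrDr -hu -hv addrA subrK.
Qed.

Lemma congr_modD m (a b c d : A) :
  congr_mod m a b -> congr_mod m c d -> congr_mod m (a + c) (b + d).
Proof.
by move=> [u hu] [v hv]; exists (u + v); rewrite mulrDr -hu -hv; ring.
Qed.

(** Write [a = p c + b]: [(p c)^p] is divisible by [p^2] because [p >= 2], and every term of the
    carry of [p c] and [b] contains [p c]. *)
Lemma congr_mod_expp (a b : A) :
  congr_mod p a b -> congr_mod (p ^ 2) (a ^+ p) (b ^+ p).
Proof.
have pE : p = p.-2.+2 by case: (p) pp => [|[|]].
move=> [c h]; rewrite -(subrK b a) h expD_prime //.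
have [d ->] : exists d, pder_carry p (p%:R * c) b = p%:R * d.
  exists (- \sum_(1 <= k < p)
    ('C(p, k) %/ p)%:R * (c * (p%:R * c) ^+ k.-1) * b ^+ (p - k)).
  rewrite /pder_carry mulrN mulr_sumr; congr (- _); apply: eq_big_nat => -[|k] //= _.
  by rewrite exprS; ring.
exists (p%:R ^+ p.-2 * c ^+ p - d).
have -> : (p%:R * c) ^+ p = (p ^ 2)%:R * (p%:R ^+ p.-2 * c ^+ p).
  by rewrite exprMn {2}pE !exprS natrX; ring.
by rewrite natrX; ring.
Qed.

End CongruenceCalculus.

(** * The curvature computation *)

Section RicciSymmetry.
Variables (B : comNzRingType) (n : nat) (K : 'M[B]_n).
Variables (Gam E : 'I_n -> 'M[B]_n).
Hypotheses (K_sym : K^T = K) (Gam_sym : forall i j k, Gam i j k = Gam j i k)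
  (Gam_const : forall i k, Gam i + (Gam i)^T = Gam k + (Gam k)^T)
  (E_def : forall i, E i = K *m (Gam i)^T).

(* [sum_j E i j k = sum_(j, l) K j l * Gam i k l] is symmetric in [i, k], and twice
   [sum_j E j j k] is the trace of [K (Gam k + Gam k^T)], which does not depend on [k]. *)
Lemma double_ricci_sym i k :
  (\sum_j (E i j k - E j j k)) *+ 2 = (\sum_j (E k j i - E j j i)) *+ 2.
Proof.
have tr2 l : (\sum_j E j j l) *+ 2 = \tr (K *m (Gam l + (Gam l)^T)).
  (* Both [tr (K Gam_l)], after a transposition, and [tr (K Gam_l^T)] equal [sum_j E j j l]. *)
  rewrite mulmxDr linearD /= mulr2n; congr (_ + _).
    rewrite -[RHS]mxtrace_tr trmx_mul K_sym mxtrace_mulC.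
    apply: eq_bigr => j _; rewrite E_def !mxE; apply: eq_bigr => m _.
    by rewrite !mxE Gam_sym.
  apply: eq_bigr => j _; rewrite E_def !mxE; apply: eq_bigr => m _.
  by rewrite !mxE Gam_sym.
rewrite !sumrB !mulrnBl !tr2 (Gam_const i k); congr (_ *+ 2 - _).
apply: eq_bigr => j _; rewrite !E_def !mxE; apply: eq_bigr => m _.
by rewrite !mxE Gam_sym.
Qed.

End RicciSymmetry.

Section FrobeniusConnection.
Variables (A : comUnitRingType) (p n : nat).
Hypotheses (pp : prime p) (p_odd : odd p) (pA : nonunit_nat A p).
Hypothesis p_tf : forall a : A, p%:R * a = 0 -> a = 0.
Variables (f : 'I_n -> {rmorphism A -> A}) (d : 'I_n -> A -> A).
Hypothesis fE : forall i a, f i a = a ^+ p + p%:R * d i a.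

(* [f k (f l a) = (a^p + p d_k a)^p + p f_k (d_l a)], and the first term is
   [a^(p^2)] mod [p^2]. *)
Lemma curvature_mod_p i j a phi : p%:R * phi = f i (f j a) - f j (f i a) ->
  congr_mod p phi (d j a ^+ p - d i a ^+ p).
Proof.
have ffE k l : exists c, f k (f l a) = a ^+ p ^+ p + p%:R * (p%:R * c + d l a ^+ p).
  have [|c hc] := @congr_mod_expp _ _ pp (a ^+ p + p%:R * d k a) (a ^+ p).
    by exists (d k a); rewrite addrC addKr.
  exists (c + d k (d l a)).
  rewrite (fE l) rmorphD rmorphM rmorph_nat rmorphXn /= !fE.
  have -> : (a ^+ p + p%:R * d k a) ^+ p = a ^+ p ^+ p + p%:R ^+ 2 * c.
    by rewrite -natrX -hc [RHS]addrC subrK.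
  by ring.
have [c ->] := ffE i j; have [c' ->] := ffE j i => h.
exists (c - c'); apply/eqP; rewrite -subr_eq0; apply/eqP/p_tf.
by rewrite !mulrBr h; ring.
Qed.

Variables (x Q : 'M[A]_n).
Hypotheses (x_unit : x \in unitmx) (x2_unit : mx_frob p 2 x \in unitmx).
Hypotheses (Q_sym : Q^T = Q) (Q_unit : Q \in unitmx).
Hypothesis fQ : forall i k j l, congr_mod (p ^ 2) (f i (Q j l)) (f k (Q j l)).
Hypothesis f_metric : forall i,
  map_mx (f i) (x^T *m Q *m x) = mx_frob p 1 (x^T *m Q *m x).

Let gam i := (map_mx (d i) x)^T *m map_mx (f i) Q *m mx_frob p 1 x.

(* Expanding [f_i(x)^T f_i(Q) f_i(x)] with [f_i x = x^(p) + p d_i x] shows that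
   [p (gam i + gam i^T)] is [(x^T Q x)^(p) - (x^(p))^T f_i(Q) x^(p)] mod [p^2]. *)
Lemma gamma_symmetrized_mod_p i k j l :
  congr_mod p ((gam i + (gam i)^T) j l) ((gam k + (gam k)^T) j l).
Proof.
pose y := mx_frob p 1 x; pose e i := map_mx (d i) x.
have fx m : map_mx (f m) x = y + p%:R *: e m.
  by apply/matrixP => a b; rewrite !mxE fE expn1.
have fQs m : (map_mx (f m) Q)^T = map_mx (f m) Q by rewrite map_trmx Q_sym.
have expand m : mx_frob p 1 (x^T *m Q *m x) = y^T *m map_mx (f m) Q *m y
    + p%:R *: (gam m + (gam m)^T + p%:R *: ((e m)^T *m map_mx (f m) Q *m e m)).
  rewrite -(f_metric m) !map_mxM -map_trmx fx [in RHS]/gam !trmx_mul trmxK fQs.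
  rewrite [(y + _)^T]linearD /= [(_ *: e m)^T]linearZ /= !mulmxDl !mulmxDr -!scalemxAl -!scalemxAr !scalerDr.
  rewrite -/y -/(e m) mulmxA -!addrA; congr (_ + _).
  by rewrite addrCA !addrA.
pose C := \matrix_(a, b) sval (cid (fQ i k a b)).
have QE : map_mx (f i) Q = map_mx (f k) Q + (p ^ 2)%:R *: C.
  apply/matrixP => a b; rewrite !mxE -(svalP (cid (fQ i k a b))).
  by rewrite addrC subrK.
(* With [S_m = gam m + (gam m)^T], subtracting the expansions for [i] and [k] gives
   [p (S_i - S_k) = p^2 T]; then [p_tf] cancels one factor [p]. *)
pose T := (e k)^T *m map_mx (f k) Q *m e k - (e i)^T *m map_mx (f i) Q *m e i
  - y^T *m C *m y.
have /matrixP/(_ j l) : gam i + (gam i)^T - (gam k + (gam k)^T) - p%:R *: T = 0.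
  apply/matrixP => a b; rewrite [RHS]mxE; apply: p_tf.
  have := expand i; rewrite (expand k) {1}QE mulmxDr mulmxDl -scalemxAr -scalemxAl.
  move=> /matrixP/(_ a b); rewrite /T natrX.
  set Y1 := y^T *m _ *m y; set Y2 := y^T *m _ *m y.
  move: (gam i + (gam i)^T) (gam k + (gam k)^T) => S1 S2.
  move: (_ *m e k) (_ *m e i) => Z1 Z2; rewrite !mxE => h.
  move/eqP: h; rewrite -subr_eq0 => /eqP h; apply/eqP; rewrite -oppr_eq0; apply/eqP.
  by rewrite -[RHS]h; ring.
clearbody T; move: (gam i + (gam i)^T) (gam k + (gam k)^T) => S1 S2; rewrite !mxE => /eqP.
by rewrite subr_eq0 => /eqP h; exists (T j l).
Qed.

Hypothesis gam_sym : forall i j k, gam i j k = gam j i k.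
Variable varphi : 'I_n -> 'I_n -> A -> A.
Hypothesis varphiE : forall i j a,
  p%:R * varphi i j a = f i (f j a) - f j (f i a).

Let psi i j := invmx (mx_frob p 2 x) *m map_mx (varphi i j) x.

Theorem ricci_sym_mod_p i k :
  congr_mod p (\sum_j psi j i j k) (\sum_j psi j k j i).
Proof.
have [B [pi piP]] := quotient_mod pA.
have p0 : p%:R = 0 :> B.
  by rewrite -(rmorph_nat pi) -(rmorph0 pi); apply/piP; exists 1; rewrite subr0 mulr1.
have pchB : p \in [pchar B] by rewrite inE pp p0 eqxx.
pose fr : {rmorphism B -> B} := pFrobenius_aut pchB.
have frE b : fr b = b ^+ p by [].
have pif m a : pi (f m a) = fr (pi a).
  by rewrite fE rmorphD rmorphM rmorph_nat p0 mul0r addr0 rmorphXn.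
pose g := map_mx pi : 'M_n -> 'M_n.
have gM a b : g (a *m b) = g a *m g b by exact: map_mxM.
have gV a : a \in unitmx -> g (invmx a) *m g a = 1%:M.
  by move=> ua; rewrite -gM mulVmx // /g map_mx1.
have gf m a : g (map_mx (f m) a) = map_mx fr (g a).
  by apply/matrixP => j l; rewrite !mxE pif.
(* In [B] every [f m] becomes the Frobenius [fr]; [X] is the image of [x^(p)] and [W] is its
   inverse. *)
pose X := map_mx fr (g x); pose W := map_mx fr (g (invmx x)).
have WX : W *m X = 1%:M by rewrite -map_mxM gV // map_mx1.
have XW := mulmx1C WX.
have gx : g (mx_frob p 1 x) = X.
  by apply/matrixP => j l; rewrite !mxE rmorphXn /= expn1.
pose V := g (invmx (mx_frob p 2 x)).
have VE : V = map_mx fr W.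
  have gx2 : g (mx_frob p 2 x) = map_mx fr X.
    by apply/matrixP => j l; rewrite !mxE expnS expn1 rmorphXn exprM.
  have h : V *m map_mx fr X = 1%:M by rewrite -gx2 gV.
  rewrite -[LHS]mulmx1 -(map_mx1 fr) -XW map_mxM mulmxA h.
  exact: mul1mx.
pose D m := g (map_mx (d m) x); pose E m := W *m D m.
(* Modulo [p] the curvature matrix is [(d_m x)^(p) - (d_j x)^(p)], and [V] is the Frobenius of [W],
   so [psi j m] is a Frobenius image as a whole. It then suffices to compare the sums before
   Frobenius is applied. *)
have psiE j m : g (psi j m) = map_mx fr (E m - E j).
  rewrite gM -/V VE -mulmxBr map_mxM; congr (_ *m _).
  apply/matrixP => a b; rewrite !mxE rmorphB !frE -!rmorphXn.
  by rewrite -rmorphB; apply/piP/curvature_mod_p.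
have RE m l : pi (\sum_j psi j m j l) = fr (\sum_j (E m j l - E j j l)).
  rewrite !rmorph_sum; apply: eq_bigr => j _.
  by have /matrixP/(_ j l) := psiE j m; rewrite !mxE.
apply/piP; rewrite !RE; congr (fr _).
pose Qb := map_mx fr (g Q); pose QVb := map_mx fr (g (invmx Q)).
have QQ : QVb *m Qb = 1%:M by rewrite -map_mxM gV // map_mx1.
have Qbs : Qb^T = Qb by rewrite /Qb /g !map_trmx Q_sym.
have QVbs : QVb^T = QVb by rewrite /QVb /g !map_trmx trmx_inv Q_sym.
have gamE m : g (gam m) = (D m)^T *m Qb *m X by rewrite !gM gx gf /D /g [in RHS]map_trmx.
have two : (\sum_j (E i j k - E j j k)) *+ 2 = (\sum_j (E k j i - E j j i)) *+ 2.
  (* This [K] is the inverse of [X^T Qb X]; since [g (gam m)^T = X^T Qb D_m], it gives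
     [K g (gam m)^T = W D_m = E m]. *)
  apply: (@double_ricci_sym _ _ (W *m QVb *m W^T) (fun m => g (gam m))).
  - by rewrite !trmx_mul trmxK QVbs mulmxA.
  - by move=> a b c; rewrite /g [LHS]mxE [RHS]mxE gam_sym.
  - move=> a b; rewrite /g !map_trmx -!map_mxD; apply/matrixP => j l.
    by rewrite [LHS]mxE [RHS]mxE; apply/piP/gamma_symmetrized_mod_p.
  - move=> m; rewrite gamE !trmx_mul trmxK Qbs -!mulmxA (mulmxA W^T) -trmx_mul XW.
    by rewrite trmx1 mul1mx (mulmxA QVb) QQ mul1mx.
(* The difference [c] is killed by 2 and by the odd number [p], so it vanishes. *)
apply/eqP; rewrite -subr_eq0; set c := _ - _; have c2 : c *+ 2 = 0.
  by rewrite mulrnBl two subrr.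
have : c *+ p = 0 by rewrite -mulr_natr p0 mulr0.
by rewrite -(odd_double_half p) p_odd mulrnDr -mul2n mulrnA c2 mul0rn addr0 mulr1n => ->.
Qed.

End FrobeniusConnection.

(** * Completions and the coordinate ring of GL_n *)

Section CompletionTheory.
Variables (A : comNzRingType) (p : nat) (pA : nonunit_nat A p).
Notation Q := {ideal_quot (null_seq pA)}.
Notation pi_ := (fun u => (\pi_Q u)%qT : completion pA).

Lemma completion_repr (a : completion pA) : exists u, a = pi_ u.
Proof. by exists (repr (a : Q)); rewrite /= reprK. Qed.

Lemma completion_eqP (u v : coherent_seq A p) :
  pi_ u = pi_ v <-> forall k, congr_mod (p ^ k) (u k) (v k).
Proof.
split=> [/eqP|h].
  rewrite -Quotient.idealrBE => /asboolP h k; have [c hc] := h k.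
  by exists c; rewrite -hc subr0.
apply/eqP; rewrite -Quotient.idealrBE; apply/asboolP => k.
by have [c hc] := h k; exists c; rewrite -hc subr0.
Qed.

Lemma coherentP (u : coherent_seq A p) k : congr_mod (p ^ k) (u k.+1) (u k).
Proof. by case: u => u /= /asboolP. Qed.

Lemma coherent_seqM (u v : coherent_seq A p) k : (u * v) k = u k * v k.
Proof. by []. Qed.

Lemma coherent_seqD (u v : coherent_seq A p) k : (u + v) k = u k + v k.
Proof. by []. Qed.

Lemma coherent_seq1 k : (1 : coherent_seq A p) k = 1.
Proof. by []. Qed.

Lemma coherent_seq_nat m k : (m%:R : coherent_seq A p) k = m%:R.
Proof. by elim: m => // m IH; rewrite -addn1 !natrD coherent_seqD IH. Qed.

(** If [p u] is null, cancelling [p] in its term of index [k + 1] shows that [u (k + 1)] vanishes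
    mod [p^k]; coherence carries this down to [u k]. *)
Lemma completion_torsion_free : (forall a : A, p%:R * a = 0 -> a = 0) ->
  forall a : completion pA, p%:R * a = 0 -> a = 0.
Proof.
move=> tf a; have [u ->] := completion_repr a.
rewrite -(rmorph_nat \pi_Q%qT) -(rmorph0 \pi_Q%qT) -rmorphM.
move=> /completion_eqP h; apply/completion_eqP => k.
apply: congr_mod_trans (congr_mod_sym (coherentP u k)) _.
have [c] := h k.+1; rewrite coherent_seqM coherent_seq_nat => hc.
exists c; apply/eqP; rewrite -subr_eq0; apply/eqP/tf.
move: hc; rewrite !subr0 expnS natrM -mulrA => hc.
by rewrite mulrBr hc subrr.
Qed.

(* The inverse is the geometric series, truncated at order [k] mod [p^k]. *)
Lemma completion_1p_unit (a : completion pA) : exists b, b * (1 + p%:R * a) = 1.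
Proof.
have [u ->] := completion_repr a.
pose w k := - (p%:R * u k).
pose v k := \sum_(l < k) w k ^+ l.
have vP : v \in @coherent A p.
  apply/asboolP => k; rewrite /v big_ord_recr /=.
  have [c hc] : congr_mod (p ^ k) (w k.+1) (w k).
    have [c hc] := coherentP u k; exists (- p%:R * c).
    by rewrite mulrCA -hc /w; ring.
  (* The sum comes from factoring the differences [w (k + 1)^l - w k^l]; the last summand accounts
     for the extra term [w (k + 1)^k] of [v (k + 1)]. *)
  exists (\sum_(l < k) c * \sum_(j < l) w k.+1 ^+ (l.-1 - j) * w k ^+ j
          + (- u k.+1) ^+ k).
  rewrite mulrDr addrAC -sumrB mulr_sumr; congr (_ + _).
    by apply: eq_bigr => l _; rewrite subrXX hc mulrA.
  by rewrite /w -mulrN exprMn natrX.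
exists (pi_ (CoherentSeq vP)).
rewrite -(rmorph_nat \pi_Q%qT) -(rmorph1 \pi_Q%qT) -!rmorphM -rmorphD -rmorphM.
apply/completion_eqP => k; rewrite coherent_seqM coherent_seqD coherent_seqM.
rewrite !coherent_seq1 coherent_seq_nat /=.
exists (- (- u k) ^+ k).
have -> : 1 + p%:R * u k = - (w k - 1) by rewrite /w; ring.
rewrite mulrN mulrC -subrX1 mulrN natrX -exprMn mulrN -/(w k).
by ring.
Qed.

End CompletionTheory.

Section CompletionMorphism.
Variables (A : comNzRingType) (p : nat) (pA : nonunit_nat A p).
Notation Q := {ideal_quot (null_seq pA)}.

Fact to_completion_zmod : zmod_morphism (to_completion pA).
Proof. by move=> a b; rewrite /to_completion -rmorphB; congr (\pi_Q _)%qT; apply: val_inj. Qed.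

Fact to_completion_monoid : monoid_morphism (to_completion pA).
Proof.
by split=> [|a b]; rewrite /to_completion -?rmorphM -?(rmorph1 \pi_Q%qT);
  congr (\pi_Q _)%qT; apply: val_inj.
Qed.

HB.instance Definition _ :=
  GRing.isZmodMorphism.Build A (completion pA) (to_completion pA) to_completion_zmod.
HB.instance Definition _ :=
  GRing.isMonoidMorphism.Build A (completion pA) (to_completion pA) to_completion_monoid.

End CompletionMorphism.

Section GLRing.
Variables (R : comNzRingType) (n : nat).
Notation S := {mpoly R[n * n]}.
Notation Q := {ideal_quot (@inv_det_ideal R n)}.

Fact GL_ring_of_zmod : zmod_morphism (@GL_ring_of R n).
Proof. by move=> a b; rewrite /GL_ring_of !rmorphB. Qed.

Fact GL_ring_of_monoid : monoid_morphism (@GL_ring_of R n).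
Proof. by split=> [|a b]; rewrite /GL_ring_of ?rmorphM ?rmorph1. Qed.

HB.instance Definition _ :=
  GRing.isZmodMorphism.Build S (GL_ring R n) (@GL_ring_of R n) GL_ring_of_zmod.
HB.instance Definition _ :=
  GRing.isMonoidMorphism.Build S (GL_ring R n) (@GL_ring_of R n) GL_ring_of_monoid.

Lemma GL_ring_eq0 (f : {poly S}) :
  (\pi_Q f)%qT = 0 <-> exists g, f = g * inv_det_rel R n.
Proof.
split=> [/eqP|[g h]].
  by rewrite -(rmorph0 \pi_Q%qT) -Quotient.idealrBE subr0 => /asboolP.
apply/eqP; rewrite -(rmorph0 \pi_Q%qT) -Quotient.idealrBE subr0.
by apply/asboolP; exists g.
Qed.

Lemma GL_ring_det_unit : exists y, y * GL_ring_of (\det (generic_mx R n)) = 1.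
Proof.
exists (\pi_Q 'X)%qT; apply/eqP; rewrite -subr_eq0; apply/eqP.
rewrite /GL_ring_of -rmorphM -(rmorph1 \pi_Q%qT) -rmorphB.
by apply/GL_ring_eq0; exists 1; rewrite mul1r mulrC.
Qed.

(* If [p f = g (det x * Y - 1)], then comparing coefficients of [Y], from the
   constant term up, shows that [p] divides [g]. *)
Lemma GL_ring_torsion_free (p : nat) : (forall a : R, p%:R * a = 0 -> a = 0) ->
  forall a : GL_ring R n, p%:R * a = 0 -> a = 0.
Proof.
move=> tfR.
have tf (f : {poly S}) : p%:R * f = 0 -> f = 0.
  move=> h; apply/polyP => k; apply/mpolyP => m; rewrite coef0 mcoeff0.
  apply: tfR; rewrite mulr_natl -mcoeffMn -coefMn -mulr_natl h.
  by rewrite coef0 mcoeff0.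
move=> a; rewrite -[a : Q]reprK; move: (repr _) => f.
rewrite -(rmorph_nat \pi_Q%qT) -rmorphM => /GL_ring_eq0[g hg].
have gp k : exists c, g`_k = p%:R * c.
  have := congr1 (fun r : {poly S} => r`_k) hg.
  rewrite /inv_det_rel mulrBr mulr1 mulrA coefB coefMX coefMC mulr_natl coefMn.
  elim: k => [|k IH] /= h.
    by exists (- f`_0); rewrite mulrN mulr_natl h sub0r opprK.
  have [|c hc] := IH.
    have := congr1 (fun r : {poly S} => r`_k) hg.
    by rewrite /inv_det_rel mulrBr mulr1 mulrA coefB coefMX coefMC mulr_natl coefMn.
  exists (\det (generic_mx R n) * c - f`_k.+1).
  by rewrite mulrBr [_ * f`__]mulr_natl h hc; ring.
pose h := \poly_(k < size g) sval (cid (gp k)).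
have gE : g = p%:R * h.
  apply/polyP => k; rewrite mulr_natl coefMn coef_poly.
  case: ltnP => hk; last by rewrite nth_default ?mul0rn.
  by rewrite [LHS](svalP (cid (gp k))) mulr_natl.
apply/GL_ring_eq0; exists h; apply/eqP; rewrite -subr_eq0; apply/eqP/tf.
by rewrite mulrBr hg gE mulrA subrr.
Qed.

End GLRing.

(** * Torsion and units in the completed coordinate ring *)

Section OGhatTheory.
Variables (F : splittingFieldType rat) (p : nat) (P : prime_ideal_over F p) (n : nat).
Hypothesis p_prime : prime p.

HB.instance Definition _ := GRing.RMorphism.copy (@poly_to_OGhat F p P n)
  (to_completion (@GL_Rhat_nonunit F p P n) \o @GL_ring_of (Rhat P) n).
HB.instance Definition _ := GRing.RMorphism.copy (@Rhat_to_OGhat F p P n)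
  (@poly_to_OGhat F p P n \o @mpolyC (n * n) (Rhat P)).

Definition loc_to_OGhat : localization P -> OGhat P n :=
  @Rhat_to_OGhat F p P n \o to_completion (@localization_nonunit F p P).
HB.instance Definition _ := GRing.RMorphism.copy loc_to_OGhat
  (@Rhat_to_OGhat F p P n \o to_completion (@localization_nonunit F p P)).

(** [F_to_OGhat] takes a default value off the localization and is not multiplicative on [F];
    algebra with the entries of [q] goes through the ring morphism [loc_to_OGhat]. *)
Lemma F_to_OGhatE (z : localization P) : F_to_OGhat P n (loc_val z) = loc_to_OGhat z.
Proof.
by rewrite /F_to_OGhat /to_Rhat -[loc_val z]/(val z) valKd.
Qed.

(** The property passes from the localization, a subring of a field of characteristic 0, to its
    completion, then to the coordinate ring, then to the completion of that. *)
Lemma OGhat_torsion_free (a : OGhat P n) : p%:R * a = 0 -> a = 0.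
Proof.
apply: completion_torsion_free; apply: GL_ring_torsion_free.
apply: completion_torsion_free => z /(congr1 val).
rewrite rmorphM rmorph_nat rmorph0 => /eqP; rewrite mulf_eq0.
have /pcharf0P -> : [pchar F] =i pred0 by move=> k; rewrite pchar_lalg Num.Theory.pchar_num.
rewrite (gtn_eqF (prime_gt0 p_prime)) /= => /eqP z0; apply: val_inj.
by rewrite [LHS]z0 rmorph0.
Qed.

(** The product [b a] has the form [1 + p c], which the geometric series inverts. *)
Lemma OGhat_unit_mod_p (a b : OGhat P n) : congr_mod p (b * a) 1 -> a \is a GRing.unit.
Proof.
move=> [c /(canRL (subrK _))]; rewrite addrC => h.
have [d hd] := completion_1p_unit c.
by apply/unitrP; exists (d * b); rewrite [a * _]mulrC -mulrA h.
Qed.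

Lemma xmx_unit : xmx P n \in unitmx.
Proof.
rewrite unitmxE det_map_mx.
have [y hy] := GL_ring_det_unit (Rhat P) n.
apply: (@OGhat_unit_mod_p _ (to_completion (@GL_Rhat_nonunit F p P n) y)).
exists 0; rewrite mulr0 -rmorphM; apply/eqP; rewrite subr_eq0 hy; apply/eqP.
exact: rmorph1.
Qed.

End OGhatTheory.

(** * Algebraic integers are p-th powers modulo p *)

Section IntegerRing.
Variable F : splittingFieldType rat.

Record integers : Type := Integers { int_val :> F; _ : int_val \in OF F }.

HB.instance Definition _ := [isSub for int_val].
HB.instance Definition _ := [Choice of integers by <:].
HB.instance Definition _ := [SubChoice_isSubComNzRing of integers by <:].

Lemma int_valP (a : integers) : val a \in OF F. Proof. exact: valP. Qed.

Definition gal_int (s : gal_of {:F}%VS) (a : integers) : integers :=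
  Integers (gal_OF s (int_valP a)).

Fact gal_int_zmod s : zmod_morphism (gal_int s).
Proof. by move=> a b; apply: val_inj; rewrite /= !rmorphB. Qed.

Fact gal_int_monoid s : monoid_morphism (gal_int s).
Proof. by split=> [|a b]; apply: val_inj; rewrite /= ?rmorphM ?rmorph1. Qed.

HB.instance Definition _ s :=
  GRing.isZmodMorphism.Build integers integers (gal_int s) (gal_int_zmod s).
HB.instance Definition _ s :=
  GRing.isMonoidMorphism.Build integers integers (gal_int s) (gal_int_monoid s).

(** Valued in the ring of integers so that it can be reduced mod [p]; being a sum of ring morphisms,
    it then commutes with [p]-th powers. *)
Definition int_trace (a : integers) : integers :=
  \sum_(s in 'Gal({:F}%VS / 1%VS)%g) gal_int s a.

Lemma int_traceE a : val (int_trace a) = galTrace 1%VS {:F}%VS (val a).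
Proof. by rewrite rmorph_sum. Qed.

Lemma int_trace_sum (I : finType) (c : I -> int) (a : I -> integers) :
  int_trace (\sum_i (c i)%:~R * a i) = \sum_i (c i)%:~R * int_trace (a i).
Proof.
rewrite /int_trace; under [RHS]eq_bigr do rewrite mulr_sumr.
rewrite exchange_big; apply: eq_bigr => s _; rewrite rmorph_sum.
by apply: eq_bigr => i _; rewrite rmorphM rmorph_int.
Qed.

Variables (p : nat) (P : prime_ideal_over F p).
Hypothesis pp : prime p.

Lemma integers_nonunit : nonunit_nat integers p.
Proof.
move=> a /(congr1 val); rewrite rmorphM rmorph_nat rmorph1 mulrC => h.
by case/negP: (prime_1 P); rewrite -h; apply: prime_mul (int_valP a) (prime_p P).
Qed.

(** Otherwise a Bezout relation between [p] and [z] would make [p] invertible in the ring of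
    integers. *)
Lemma dvdz_integers (z : int) : congr_mod p (z%:~R : integers) 0 -> (p %| z)%Z.
Proof.
case=> c; rewrite subr0 => hc; apply: contraT => pz.
have : coprimez p z by rewrite coprimezE prime_coprime.
case/coprimezP=> [[u v]] /= uv; case: (@integers_nonunit (u%:~R + v%:~R * c)).
rewrite mulrDr mulrCA -hc -[p%:R]/((Posz p)%:~R) -!rmorphM -rmorphD /=.
by rewrite mulrC uv.
Qed.

Variables (d : int) (m : nat) (b : 'I_m -> F).
Hypotheses (bP : integral_basis b) (pd : ~~ (p %| d)%Z)
  (dE : d%:~R = \det (\matrix_(i, j) galTrace 1%VS {:F}%VS (b i * b j))).

Let bO i := Integers (bP.1 i).

Lemma integral_basis_coord (a : integers) :
  exists c : 'I_m -> int, a = \sum_i (c i)%:~R * bO i.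
Proof.
have [c [hc _]] := bP.2 _ (int_valP a); exists c; apply: val_inj.
rewrite hc rmorph_sum; apply: eq_bigr => i _.
by rewrite rmorphM rmorph_int /= mulrzl.
Qed.

(* If [C] is the matrix of Frobenius on the basis and [T] the trace form, then
   [C T C^t = T^(p)] mod [p], hence [det C ^ 2 * d = d ^ p = d] mod [p] and [C] is
   invertible mod [p]. *)
Lemma integers_frobenius_surj (a : integers) :
  exists w c, a = w ^+ p + p%:R * c.
Proof.
have [B [pi piP]] := quotient_mod integers_nonunit.
have p0 : p%:R = 0 :> B.
  by rewrite -(rmorph_nat pi) -(rmorph0 pi); apply/piP; exists 1; rewrite subr0 mulr1.
have pchB : p \in [pchar B] by rewrite inE pp p0 eqxx.
pose fr : {rmorphism B -> B} := pFrobenius_aut pchB.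
have frE r : fr r = r ^+ p by [].
pose C := \matrix_(i, j) sval (cid (integral_basis_coord (bO i ^+ p))) j.
have CE i : bO i ^+ p = \sum_j (C i j)%:~R * bO j.
  rewrite [LHS](svalP (cid (integral_basis_coord (bO i ^+ p)))).
  by apply: eq_bigr => j _; rewrite mxE.
pose T := \matrix_(i, j) int_trace (bO i * bO j).
pose CO : 'M[integers]_m := map_mx intr C; pose CB : 'M[B]_m := map_mx intr C.
have piC : map_mx pi CO = CB by apply/matrixP => i j; rewrite !mxE rmorph_int.
have detT : \det T = d%:~R.
  apply: val_inj; rewrite rmorph_int dE -det_map_mx; congr (\det _).
  by apply/matrixP => i j; rewrite !mxE; apply: int_traceE.
have TC : CO *m T *m CO^T = \matrix_(i, j) int_trace ((bO i * bO j) ^+ p).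
  apply/matrixP => i j; rewrite !mxE exprMn (CE j) mulr_sumr.
  have -> : \sum_l bO i ^+ p * ((C j l)%:~R * bO l)
      = \sum_l (C j l)%:~R * (bO i ^+ p * bO l).
    by apply: eq_bigr => l _; rewrite mulrCA.
  rewrite int_trace_sum; apply: eq_bigr => l _; rewrite !mxE mulrC; congr (_ * _).
  have -> : bO i ^+ p * bO l = \sum_k (C i k)%:~R * (bO k * bO l).
    by rewrite CE mulr_suml; apply: eq_bigr => k _; rewrite mulrA.
  by rewrite int_trace_sum; apply: eq_bigr => k _; rewrite !mxE.
have trp r : pi (int_trace (r ^+ p)) = fr (pi (int_trace r)).
  rewrite /int_trace !rmorph_sum; apply: eq_bigr => s _.
  by rewrite frE !rmorphXn.
have dB : (\det CB) ^+ 2 * d%:~R = d%:~R.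
  have : CB *m map_mx pi T *m CB^T = map_mx fr (map_mx pi T).
    rewrite -piC map_trmx -!map_mxM TC; apply/matrixP => i j; rewrite !mxE.
    by rewrite trp.
  move/(congr1 determinant); rewrite !det_mulmx det_tr !det_map_mx detT.
  by rewrite !rmorph_int => h; rewrite -[RHS]h; ring.
have detC : ~~ (p %| \det C)%Z.
  apply: contra pd => /dvdzP[z hz].
  apply: dvdz_integers; apply/piP; rewrite rmorph0 rmorph_int -dB.
  by rewrite /CB det_map_mx hz rmorphM /= -[(Posz p)%:~R]/(p%:R) p0 mulr0 expr0n mul0r.
have : coprimez p (\det C) by rewrite coprimezE prime_coprime.
case/coprimezP=> [[u v]] /= uv.
(* [v] inverts [det C] mod [p], so [v adj C] inverts [C] and expresses each basis element through
   the [b_i^p]. Frobenius fixes the integer coefficients, so each basis element is itself a [p]-th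
   power mod [p]. *)
have vC : v%:~R *: (\adj CB *m CB) = 1%:M.
  rewrite mul_adj_mx scale_scalar_mx /CB det_map_mx -rmorphM.
  have -> : v * \det C = 1 - u * Posz p by rewrite -uv addrAC subrr add0r.
  by rewrite rmorphB rmorphM /= -[(Posz p)%:~R]/(p%:R) p0 mulr0 subr0.
have bE j : pi (bO j) = fr (pi (\sum_i (v * \adj C j i)%:~R * bO i)).
  have /matrixP/(_ j) : (v%:~R *: (\adj CB *m CB)) *m \col_i pi (bO i) = \col_i pi (bO i).
    by rewrite vC mul1mx.
  move=> /(_ ord0); rewrite [RHS]mxE => <-.
  rewrite -scalemxAl -mulmxA 2!mxE mulr_sumr !rmorph_sum; apply: eq_bigr => i _.
  rewrite !rmorphM !rmorph_int mulrA; congr (_ * _).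
    by rewrite /CB -map_mx_adj mxE.
  rewrite frE -rmorphXn CE rmorph_sum mxE; apply: eq_bigr => k _.
  by rewrite !mxE rmorphM rmorph_int.
have [c aE] := integral_basis_coord a.
pose w := \sum_j (c j)%:~R * \sum_i (v * \adj C j i)%:~R * bO i.
have /piP[e he] : pi a = pi (w ^+ p).
  rewrite rmorphXn -frE aE /w !rmorph_sum; apply: eq_bigr => j _.
  by rewrite !rmorphM !rmorph_int bE.
by exists w, e; rewrite -he addrC subrK.
Qed.

End IntegerRing.

(** * Rigidity of Frobenius lifts *)

Section FrobeniusLifts.
Variables (A : comNzRingType) (p : nat).
Hypothesis pp : prime p.

(* [f] and [g] agree mod [p], hence on [p]-th powers and on multiples of [p] they
   agree mod [p^2]. *)
Lemma frobenius_lift_unique_mod_p2 (O : comNzRingType) (iota : {rmorphism O -> A})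
    (f g : {rmorphism A -> A}) :
  (forall a : O, exists w c, a = w ^+ p + p%:R * c) ->
  is_frobenius_lift p f -> is_frobenius_lift p g ->
  forall a, congr_mod (p ^ 2) (f (iota a)) (g (iota a)).
Proof.
move=> surj fl gl a.
have fg b : congr_mod p (f (iota b)) (g (iota b)).
  exact: congr_mod_trans (fl _) (congr_mod_sym (gl _)).
have [w [c ->]] := surj a.
rewrite !rmorphD !rmorphXn !rmorphM !rmorph_nat.
apply: congr_modD; first exact/congr_mod_expp.
by have [e he] := fg c; exists e; rewrite -mulrBr he natrX mulrA.
Qed.

(** A Bezout relation [u p^e + v M^k = 1] makes [M^k] invertible mod [p^e]. *)
Lemma congr_mod_cancel (M : int) e k (a b : A) : coprimez p M ->
  congr_mod (p ^ e) (M%:~R ^+ k * a) (M%:~R ^+ k * b) -> congr_mod (p ^ e) a b.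
Proof.
move=> pM [c hc].
have : coprimez (Posz (p ^ e)) (M ^+ k).
  by rewrite coprimezE abszX coprimeXl ?coprimeXr // -coprimezE.
case/coprimezP=> [[u v]] /= uv; exists (u%:~R * (a - b) + v%:~R * c).
rewrite mulrDr mulrCA (mulrCA _ v%:~R) -hc -mulrBr -rmorphXn /=.
rewrite -[(p ^ e)%:R]/((Posz (p ^ e))%:~R) !mulrA -!rmorphM -mulrDl -rmorphD /=.
by rewrite uv mul1r.
Qed.

Variable B : comNzRingType.
Variables (s : {rmorphism A -> B}) (t : B -> A).
Hypotheses (sK : cancel s t) (tK : cancel t s).

(** The inverses of the gauge isomorphisms are given as bare maps; the morphism structure allows
    matrix products to be pushed through them. *)
Lemma inverse_rmorphism : exists t' : {rmorphism B -> A}, t' =1 t.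
Proof.
have tz := can2_zmod_morphism sK tK; have tm := can2_monoid_morphism sK tK.
pose T1 := GRing.isZmodMorphism.Build B A t tz.
pose T2 := GRing.isMonoidMorphism.Build B A t tm.
by exists (HB.pack t T1 T2 : {rmorphism B -> A}).
Qed.

(** The first formula identifies [f] with a transported lift; the second exhibits it as a Frobenius
    lift and names its [p]-derivation. *)
Lemma conj_attached_lift (delta : B -> B) : p_derivation p delta ->
  exists f : {rmorphism A -> A}, forall a,
    f a = t (attached_lift p delta (s a)) /\
    f a = a ^+ p + p%:R * t (delta (s a)).
Proof.
move=> dd; have [t' tE] := inverse_rmorphism.
pose T1 := GRing.isZmodMorphism.Build B B (attached_lift p delta)
  (attached_lift_zmod pp dd).
pose T2 := GRing.isMonoidMorphism.Build B B (attached_lift p delta)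
  (attached_lift_monoid dd).
pose phi : {rmorphism B -> B} := HB.pack (attached_lift p delta) T1 T2.
exists (t' \o phi \o s) => a; rewrite -!tE; split=> //.
rewrite -[LHS]/(t' (s a ^+ p + p%:R * delta (s a))).
by rewrite rmorphD rmorphM rmorph_nat rmorphXn /= [t' (s a)]tE sK.
Qed.

End FrobeniusLifts.

(** In characteristic [p] the [p]-th power is a ring morphism, so applying it entrywise commutes
    with determinants. *)
Lemma det_mx_frob_mod_p (A : comUnitRingType) (p n e : nat) (x : 'M[A]_n) :
  prime p -> nonunit_nat A p ->
  congr_mod p (\det (mx_frob p e x)) (\det x ^+ (p ^ e)).
Proof.
move=> pp pA; have [B [pi piP]] := quotient_mod pA.
have p0 : p%:R = 0 :> B.
  by rewrite -(rmorph_nat pi) -(rmorph0 pi); apply/piP; exists 1; rewrite subr0 mulr1.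
have pchB : p \in [pchar B] by rewrite inE pp p0 eqxx.
apply/piP; elim: e => [|e IH].
  by rewrite expn0 expr1; congr (pi (\det _)); apply/matrixP => i j; rewrite mxE expr1.
rewrite expnSr exprM rmorphXn -IH -rmorphXn.
have -> : pi (\det (mx_frob p e x) ^+ p) =
    pFrobenius_aut pchB (pi (\det (mx_frob p e x))) by rewrite rmorphXn.
rewrite -!det_map_mx; congr (\det _); apply/matrixP => i j; rewrite !mxE.
by rewrite expnSr exprM; apply: rmorphXn.
Qed.

Lemma mx_frob_unit (A : comUnitRingType) (p n e : nat) (x : 'M[A]_n) :
  prime p -> nonunit_nat A p ->
  (forall a b : A, congr_mod p (b * a) 1 -> a \is a GRing.unit) ->
  x \in unitmx -> mx_frob p e x \in unitmx.
Proof.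
move=> pp pA unit_mod xu; rewrite unitmxE.
apply: (unit_mod _ ((\det x)^-1 ^+ (p ^ e))).
have [c hc] := det_mx_frob_mod_p e x pp pA.
exists ((\det x)^-1 ^+ (p ^ e) * c); rewrite mulrCA -hc mulrBr; congr (_ - _).
by rewrite -exprMn mulVr ?expr1n // -unitmxE.
Qed.

(** * Algebraic integers and the entries of [q] in the completed coordinate ring *)

Section IntegersInOGhat.
Variables (F : splittingFieldType rat) (p : nat) (P : prime_ideal_over F p) (n : nat).

Fact integers_in_localization (a : integers F) : val a \in in_localization P.
Proof.
apply/asboolP; exists (val a), 1.
by rewrite int_valP rpred1 prime_1 divr1.
Qed.

Definition integers_to_loc (a : integers F) : localization P :=
  Localization (integers_in_localization a).

Fact integers_to_loc_zmod : zmod_morphism integers_to_loc.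
Proof. by move=> a b; apply: val_inj. Qed.

Fact integers_to_loc_monoid : monoid_morphism integers_to_loc.
Proof. by split=> [|a b]; apply: val_inj. Qed.

HB.instance Definition _ := GRing.isZmodMorphism.Build (integers F) (localization P)
  integers_to_loc integers_to_loc_zmod.
HB.instance Definition _ := GRing.isMonoidMorphism.Build (integers F) (localization P)
  integers_to_loc integers_to_loc_monoid.

(** Some [M^k z] is an algebraic integer, where rigidity applies because [p] is prime to [d]; then
    [M^k], being prime to [p], is cancelled. *)
Lemma frobenius_lift_OF_inv (d M : int) (f g : {rmorphism OGhat P n -> OGhat P n}) :
  prime p -> is_discriminant F d -> (d %| M)%Z -> ~~ (p %| M)%Z ->
  is_frobenius_lift p f -> is_frobenius_lift p g ->
  forall z, z \in OF_inv F M ->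
    congr_mod (p ^ 2) (f (F_to_OGhat P n z)) (g (F_to_OGhat P n z)).
Proof.
move=> pp [m [b [bP dE]]] dM pM fl gl z zM.
have pd : ~~ (p %| d)%Z by apply: contra pM => /dvdz_trans; apply.
have cM : coprimez p M by rewrite coprimezE prime_coprime.
have zP := OF_inv_localization P pp pM zM.
pose zl := Localization zP.
rewrite -[z]/(loc_val zl) F_to_OGhatE.
case/asboolP: zM => k hk; apply: (@congr_mod_cancel _ _ M _ k) => //.
pose a : integers F := Integers hk.
have aE : integers_to_loc a = M%:~R ^+ k * zl.
  by apply: val_inj; rewrite rmorphM rmorphXn rmorph_int.
have lE (h : {rmorphism OGhat P n -> OGhat P n}) :
    M%:~R ^+ k * h (loc_to_OGhat n zl) = h (loc_to_OGhat n (integers_to_loc a)).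
  by rewrite aE !rmorphM !rmorphXn !rmorph_int.
rewrite !lE.
apply: (@frobenius_lift_unique_mod_p2 _ _ pp _ (@loc_to_OGhat _ _ P n \o integers_to_loc) f g) => //.
by have := integers_frobenius_surj P pp bP pd dE.
Qed.

(** The inverse is the image of [invmx q]: both matrices lift to the localization, where the map is
    multiplicative. *)
Lemma F_to_OGhat_unitmx m (q : 'M[F]_m) : q \in unitmx ->
  (forall i j, q i j \in in_localization P) ->
  (forall i j, invmx q i j \in in_localization P) ->
  map_mx (F_to_OGhat P n) q \in unitmx.
Proof.
move=> qu qP qVP.
pose ql := \matrix_(i, j) Localization (qP i j).
pose qVl := \matrix_(i, j) Localization (qVP i j).
have E1 : map_mx (F_to_OGhat P n) q = map_mx (@loc_to_OGhat _ _ P n) ql.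
  by apply/matrixP => i j; rewrite !mxE -F_to_OGhatE.
have h : qVl *m ql = 1%:M.
  apply/matrixP => i j; apply: val_inj.
  have /matrixP/(_ i j) := mulVmx qu; rewrite !mxE => h.
  rewrite rmorph_sum rmorph_nat -[RHS]h; apply: eq_bigr => k _.
  by rewrite !mxE.
have := map_mxM (@loc_to_OGhat _ _ P n) qVl ql; rewrite h map_mx1 => /esym.
by rewrite E1 => /mulmx1_unit[].
Qed.

End IntegersInOGhat.

(** * Transport to the first index *)

Section TransportedConnection.
Variables (n p : nat) (o : 'I_n) (A : 'I_n -> comUnitRingType).
Hypotheses (pp : prime p) (p_odd : odd p) (pA : nonunit_nat (A o) p).
Hypothesis p_tf : forall a : A o, p%:R * a = 0 -> a = 0.
Variables (s : forall i, {rmorphism A o -> A i}) (sinv : forall i, A i -> A o).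
Arguments sinv : clear implicits.
Hypotheses (sK : forall i, cancel (s i) (sinv i))
  (sVK : forall i, cancel (sinv i) (s i)).
Variable delta : forall i, A i -> A i.
Arguments delta : clear implicits.
Hypothesis delta_der : forall i, p_derivation p (delta i).
Variables x q : forall i, 'M[A i]_n.
Hypotheses (sx : forall i, map_mx (s i) (x o) = x i)
  (sq : forall i, map_mx (s i) (q o) = q i).
Hypotheses (x_unit : x o \in unitmx) (x2_unit : mx_frob p 2 (x o) \in unitmx).
Hypotheses (q_sym : (q o)^T = q o) (q_unit : q o \in unitmx).
Hypothesis q_rigid : forall f g : {rmorphism A o -> A o},
  is_frobenius_lift p f -> is_frobenius_lift p g ->
  forall j l, congr_mod (p ^ 2) (f (q o j l)) (g (q o j l)).

Let phi i := attached_lift p (delta i).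
Arguments phi : clear implicits.
Let gamma i := (map_mx (delta i) (x i))^T *m map_mx (phi i) (q i) *m mx_frob p 1 (x i).

Hypothesis phi_metric : forall i, map_mx (phi i) ((x i)^T *m q i *m x i) =
  mx_frob p 1 ((x i)^T *m q i *m x i).
Hypothesis gamma_sym : forall i j k,
  sinv i (gamma i j k) = sinv j (gamma j i k).
Variable varphi : 'I_n -> 'I_n -> A o -> A o.
Let lift i a := sinv i (phi i (s i a)).
Hypothesis varphiE : forall i j a,
  p%:R * varphi i j a = lift i (lift j a) - lift j (lift i a).

Let psi i j := invmx (mx_frob p 2 (x o)) *m map_mx (varphi i j) (x o).

(** Conjugation by the [s i] yields Frobenius lifts on the single ring [A o]. As [s i] matches the
    matrices [x] and [q], the metric and torsion-free conditions become those of
    [ricci_sym_mod_p]. *)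
Theorem transported_ricci_sym_mod_p i k :
  congr_mod p (\sum_j psi j i j k) (\sum_j psi j k j i).
Proof.
have fP l := conj_attached_lift pp (@sK l) (@sVK l) (@delta_der l).
pose f l := sval (cid (fP l)); pose d l a := sinv l (delta l (s l a)).
have fT l a : f l a = lift l a by have [] := svalP (cid (fP l)) a.
have fE l a : f l a = a ^+ p + p%:R * d l a by have [] := svalP (cid (fP l)) a.
have f_lift l : is_frobenius_lift p (f l).
  by move=> a; exists (d l a); rewrite fE addrC addKr.
apply: (@ricci_sym_mod_p (A o) p n pp p_odd pA p_tf f d fE (x o) (q o)) => //.
- by move=> a b j l; apply: q_rigid.
- move=> l; apply/matrixP => a b; have /matrixP/(_ a b) := phi_metric l.
  rewrite -(sx l) -(sq l) map_trmx -!map_mxM !mxE fT /lift => ->.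
  by rewrite -rmorphXn sK.
- move=> a b c; have gE l : map_mx (d l) (x o) = map_mx (sinv l) (map_mx (delta l) (x l)) /\
      map_mx (f l) (q o) = map_mx (sinv l) (map_mx (phi l) (q l)) /\
      mx_frob p 1 (x o) = map_mx (sinv l) (mx_frob p 1 (x l)).
    rewrite -(sx l) -(sq l); split; [|split]; apply/matrixP => j m.
    - by rewrite !mxE.
    - by rewrite 3!mxE fT mxE.
    - by rewrite !mxE -rmorphXn sK.
  have gamE l j m : ((map_mx (d l) (x o))^T *m map_mx (f l) (q o) *m mx_frob p 1 (x o)) j m
      = sinv l (gamma l j m).
    have [t tE] := inverse_rmorphism (@sK l) (@sVK l).
    have tmx u v (M : 'M[A l]_(u, v)) : map_mx (sinv l) M = map_mx t M.
      by apply/matrixP => ? ?; rewrite !mxE tE.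
    have [-> [-> ->]] := gE l.
    by rewrite !tmx map_trmx -!map_mxM mxE tE.
  by rewrite !gamE.
- by move=> a b c; rewrite !fT.
Qed.

End TransportedConnection.

(** This evaluates the metric condition at the coordinates; it is applied with [y = x^t q x]. *)
Lemma map_frob_metric (A : comNzRingType) (p m : nat) (H phi0 : {rmorphism A -> A})
    (phi : A -> A) (x y : 'M[A]_m) :
  (forall a, phi (H a) = H (phi0 a)) -> map_mx H x = y ->
  map_mx phi0 x = mx_frob p 1 x -> map_mx phi y = mx_frob p 1 y.
Proof.
move=> E <- /matrixP h; apply/matrixP => j k; rewrite !mxE E.
by have := h j k; rewrite !mxE => ->; rewrite rmorphXn.
Qed.

(** The identity is asked only on the entries of [a], because [s i] is known to act as [sigma i]
    only on images of the localization. *)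
Lemma map_mx_factor (T U V : Type) (m : nat) (f : U -> V) (g : T -> U) (h : T -> V)
    (a : 'M[T]_m) :
  (forall i j, f (g (a i j)) = h (a i j)) -> map_mx f (map_mx g a) = map_mx h a.
Proof. by move=> E; apply/matrixP => i j; rewrite !mxE. Qed.

Theorem corollary3p6 (F : splittingFieldType rat) (d M : int) (N p : nat)
    (P : prime_ideal_over F p) (sigma : 'I_N.+1 -> gal_of {:F}%VS)
    (q : 'M[F]_N.+1)
    (F_disc : is_discriminant F d) (M_even : (2 %| M)%Z) (M_disc : (d %| M)%Z)
    (sigma_1 : sigma ord0 = 1%g)
    (p_prime : prime p) (p_M : ~~ (p %| M)%Z)
    (q_unit : q \in unitmx)
    (q_int : forall i j, q i j \in OF_inv F M)
    (qV_int : forall i j, invmx q i j \in OF_inv F M)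
    (q_sym : q^T = q)
    (q_inv : forall i, map_mx (sigma i) q = q)
    (sR : forall i, {rmorphism R_ P sigma ord0 -> R_ P sigma i})
    (s : forall i, {rmorphism OG_ P sigma ord0 -> OG_ P sigma i})
    (sinv : forall i, OG_ P sigma i -> OG_ P sigma ord0)
    (s_gauge : gauge_action sR s sinv)
    (deltaR : forall i, R_ P sigma i -> R_ P sigma i)
    (deltaR_der : forall i, p_derivation p (deltaR i))
    (H phi0 : forall i, {rmorphism OG_ P sigma i -> OG_ P sigma i})
    (H_metric : metric_map q H)
    (phi0_lift : standard_lift deltaR phi0)
    (delta : forall i, OG_ P sigma i -> OG_ P sigma i)
    (delta_conn : vertical_connection deltaR delta)
    (delta_metric : metric delta H phi0)
    (delta_torsion_free : torsion_free q delta sinv)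
    (varphi : 'I_N.+1 -> 'I_N.+1 -> OG_ P sigma ord0 -> OG_ P sigma ord0)
    (varphi_curv : is_curvature delta s sinv varphi) :
  forall i k : 'I_N.+1, congr_mod p (Ricci varphi i k) (Ricci varphi k i).
Proof.
have pA : nonunit_nat (OG_ P sigma ord0) p by exact: completion_nonunit.
have p_odd : odd p.
  by case: (even_prime p_prime) => // p2; move: p_M; rewrite p2 M_even.
have qP i j k : q j k \in in_localization (gauge_prime P sigma i).
  exact: OF_inv_localization p_prime p_M _ (q_int j k).
have x_unit : x_ P sigma ord0 \in unitmx by exact: xmx_unit.
apply: (@transported_ricci_sym_mod_p N.+1 p ord0 (OG_ P sigma) p_prime p_odd pA _
  s sinv _ _ delta _ (x_ P sigma) (q_ P sigma q)).
- exact: OGhat_torsion_free.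
- by move=> i; have [] := s_gauge i.
- by move=> i; have [] := s_gauge i.
- by move=> i; have [] := delta_conn i.
- by move=> i; have [] := s_gauge i.
- move=> i; have [sRE sE _ _ _] := s_gauge i.
  apply: map_mx_factor => j k.
  (* Gauge invariance enters here: [s i] sends the image of [z] to the image of [sigma i z], and
     [sigma i] fixes the entries of [q]. *)
  have /matrixP/(_ j k) := q_inv i; rewrite mxE => qE.
  apply: etrans (sE _) _; apply: congr1; apply: etrans (sRE _ (qP _ _ _)) _.
  by rewrite qE.
- exact: x_unit.
- by apply: mx_frob_unit => // a b; apply: OGhat_unit_mod_p.
- by rewrite /q_ map_trmx q_sym.
- apply: F_to_OGhat_unitmx => // j k.
  exact: OF_inv_localization p_prime p_M _ (qV_int j k).
- move=> f g fl gl j l; rewrite mxE.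
  exact: frobenius_lift_OF_inv p_prime F_disc M_disc p_M fl gl _ (q_int j l).
- move=> i; have [_ HE] := H_metric i; have [_ _ phi0E] := phi0_lift i.
  exact: map_frob_metric (delta_metric i) HE phi0E.
- exact: delta_torsion_free.
- exact: varphi_curv.
Qed.
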